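(* Let $m \geq 1$ be an integer and let $a_m = \nu_2(m(m+1))$. Then \[ m \equiv C(m) \equiv C^2(m) \equiv \cdots \equiv C^{a_m - 1}(m) \not\equiv C^{a_m}(m) \pmod 2, \] i.e. $a_m$ is the first time at which the orbit $m, C(m), C^2(m), \dots$ changes parity.
   Context: $\nu_2$ denotes the $2$-adic valuation. The Collatz map $C:\mathbb{N}\to\mathbb{N}$ is $C(i) = i/2$ if $i$ is even and $C(i) = (3i+1)/2$ if $i$ is odd; $C^k$ denotes its $k$-fold iterate. (In the paper, $a_m$ is also identified with $\nu_2(A_{1,m}) - 1$ for a certain integer sequence $A_{1,m}$.) *)

(* Defs.v *)
From mathcomp Require Import all_boot.

Set Implicit Arguments.
Unset Strict Implicit.
Unset Printing Implicit Defensive.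

(* Both quotients are exact. *)
Definition collatz (i : nat) : nat :=
  if odd i then (3 * i + 1) %/ 2 else i %/ 2.

(* Main.v *)
(** Halving an even [m] lowers the 2-adic valuation of [m] by one, and for odd
    [m] the identity [C(m) + 1 = 3 (m + 1) / 2] lowers that of [m + 1] by one.
    One of [m], [m + 1] is odd, so [a] is the valuation of the other one, and
    parity flips exactly when that valuation has been exhausted. *)

Require Import Defs.
From mathcomp Require Import all_boot.
From mathcomp Require Import zify.

Lemma collatz_double n : collatz n.*2 = n.
Proof. by rewrite /collatz odd_double divn2 doubleK. Qed.

Lemma collatz_oddS n : odd n -> (collatz n).+1.*2 = 3 * n.+1.
Proof. rewrite /collatz => on; rewrite on; lia. Qed.

Lemma iter_collatz_even a q k :
  k <= a -> iter k collatz (2 ^ a * q) = 2 ^ (a - k) * q.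
Proof.
elim: k => [|k IHk] ka; first by rewrite subn0.
rewrite iterS IHk; last exact: ltnW.
by rewrite -(subnSK ka) expnS -mulnA mul2n collatz_double.
Qed.

(** Each odd step trades one factor 2 of the successor for a factor 3. *)
Lemma iter_collatz_odd a q m k : m.+1 = 2 ^ a * q ->
  k <= a -> (iter k collatz m).+1 = 3 ^ k * (2 ^ (a - k) * q).
Proof.
move=> mE; elim: k => [|k IHk] ka; first by rewrite subn0 mul1n.
have {IHk} := IHk (ltnW ka).
rewrite -(subnSK ka) (expnS 2) -mulnA mulnCA mul2n iterS => E.
(* Since [k < a], a factor 2 is left: [E] makes the successor a double. *)
have ok : odd (iter k collatz m).
  by rewrite -[odd _]negbK -oddS E odd_double.
by apply: double_inj; rewrite collatz_oddS // E expnS -mulnA -!doubleMr.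
Qed.

Lemma odd_exp2_mul b q : odd q -> odd (2 ^ b * q) = (b == 0).
Proof. by move=> oq; rewrite oddM oq andbT oddX orbF. Qed.

Lemma logn2_split n : 0 < n -> exists2 q, odd q & n = 2 ^ logn 2 n * q.
Proof.
move=> n_gt0; have [q cq nE] := pfactor_coprime (isT : prime 2) n_gt0.
by exists q; [rewrite -coprime2n | rewrite mulnC].
Qed.

Lemma logn2_odd n : odd n -> logn 2 n = 0.
Proof. by move=> on; apply: logn_coprime; rewrite coprime2n. Qed.

(** One of two consecutive integers is even. *)
Lemma logn2_mulS_gt0 m : 0 < m -> 0 < logn 2 (m * m.+1).
Proof.
move=> m_gt0; rewrite logn_gt0 mem_primes /= muln_gt0 m_gt0 /= dvdn2.
by rewrite oddM oddS andbN.
Qed.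

(** Serves both halves of the theorem: the power of 2 left after [k] steps is [2 ^ (a - k)], which
    is odd only at [k = a]. *)
Lemma odd_iter_collatz m k (a := logn 2 (m * m.+1)) : 0 < m -> k <= a ->
  odd (iter k collatz m) = odd m (+) (k == a).
Proof.
move=> m_gt0; have aE : a = logn 2 m + logn 2 m.+1 by rewrite /a lognM.
have [om|em] := boolP (odd m) => ka.
  have {}aE : a = logn 2 m.+1 by rewrite aE logn2_odd.
  have [q oq] := logn2_split m.+1 isT; rewrite -aE => mE.
  (* Parity is read off the successor, where the odd factor [3 ^ k] has no effect. *)
  rewrite -[LHS]negbK -oddS (iter_collatz_odd _ _ _ _ mE ka) oddM oddX orbT.
  by rewrite odd_exp2_mul // subn_eq0 eqn_leq ka.
have {}aE : a = logn 2 m by rewrite aE [logn 2 m.+1]logn2_odd ?addn0.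
have [q oq] := logn2_split m m_gt0; rewrite -aE => mE.
by rewrite {1}mE iter_collatz_even // odd_exp2_mul // subn_eq0 eqn_leq ka.
Qed.

Theorem theorem6p1 (m : nat) (hm : 1 <= m) :
  let a := logn 2 (m * (m + 1)) in
  (forall k : nat, k + 1 <= a - 1 ->
     iter k collatz m = iter (k + 1) collatz m %[mod 2]) /\
  iter (a - 1) collatz m <> iter a collatz m %[mod 2].
Proof.
rewrite addn1 /=; have a_gt0 := logn2_mulS_gt0 m hm.
have oddE k := odd_iter_collatz m k hm.
set a := logn 2 _ in a_gt0 oddE *; split=> [k ka|].
  (* Both [k] and [k + 1] lie below [a], so neither parity has flipped. *)
  by rewrite !modn2 !oddE; [congr (nat_of_bool (_ (+) _)) | |]; lia.
rewrite !modn2 !oddE ?eqxx ?leq_subr //.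
(* Subtraction is truncated, so this rests on [a_gt0]. *)
have -> : (a - 1 == a) = false by lia.
by case: (odd m).
Qed.
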